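(* Let $R$ be a commutative finite chain ring of nilpotency index $e$ and residue field $\mathbb{F}_q$, and let $n$ be a positive integer. Then $$d_n(R,1)=q^{e(n^2-1)}\prod_{i=2}^n (1-q^{-i}).$$
   Context: A commutative finite chain ring is a finite commutative ring with identity $1\neq 0$ whose ideals are linearly ordered by inclusion. Such a ring $R$ has a unique maximal ideal, which is principal; let $\gamma$ be a generator of it. The nilpotency index of $R$ is the smallest positive integer $e$ with $\gamma^e=0$. The residue field of $R$ is the finite field $R/\gamma R$; it is $\mathbb{F}_q$, where $q$ is a prime power. For a commutative ring $S$ and $a\in S$, $d_n(S,a)$ denotes the number of $n\times n$ matrices over $S$ whose determinant is $a$. An empty product equals $1$. *)

(* Defs.v *)
From HB Require Import structures.
From mathcomp Require Import all_boot all_order all_algebra.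

Set Implicit Arguments.
Unset Strict Implicit.
Unset Printing Implicit Defensive.

Import GRing.Theory.
Local Open Scope ring_scope.

(* Unlike the library's [idealr], this allows the improper ideal. *)
Definition is_ideal (R : finComNzRingType) (I : {set R}) : Prop :=
  [/\ 0 \in I,
      forall x y, x \in I -> y \in I -> x + y \in I
    & forall a x, x \in I -> a * x \in I].

Definition chain_ring (R : finComNzRingType) : Prop :=
  forall I J : {set R}, is_ideal I -> is_ideal J ->
    (I \subset J) || (J \subset I).

(* Every [J : idealr R] is a proper ideal. *)
Definition maximal_ideal (R : finComNzRingType) (m : idealr R) : Prop :=
  forall J : idealr R, {subset m <= J} -> J =i m.

Definition generates (R : finComNzRingType) (g : R) (m : idealr R) : Prop :=
  forall x, x \in m <-> exists a, x = g * a.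

(* This does not depend on the choice of the generator [g]. *)
Definition nilpotency_index (R : finComNzRingType) (e : nat) : Prop :=
  exists (m : idealr R) (g : R),
    [/\ maximal_ideal m, generates g m, (0 < e)%N, g ^+ e = 0
      & forall k, (0 < k)%N -> g ^+ k = 0 -> (e <= k)%N].

Definition residue_field (R : finComNzRingType) (F : finFieldType) : Prop :=
  exists (m : idealr R) (f : {rmorphism {ideal_quot m} -> F}),
    maximal_ideal m /\ bijective f.

Definition d_ (n : nat) (S : finComPzRingType) (a : S) : nat :=
  #|[set A : 'M[S]_n | \det A == a]|.

(* Main.v *)
Require Import Defs.
From mathcomp Require Import all_boot all_order all_algebra.
From mathcomp Require Import ring zify.
Import GRing.Theory Num.Theory.
Local Open Scope ring_scope.

(** The residue map [phi : R -> F] is a surjective ring morphism whose kernel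
    [g R] consists of nilpotent elements, so an element of [R] is invertible
    exactly when its residue is nonzero. As all fibres of a surjective additive
    map have the same size, a uniformly random matrix over [R] reduces to a
    uniformly random matrix over [F]; it therefore has an invertible determinant
    with probability [\prod_(1 <= i < n.+1) (1 - q^-i)], the proportion of
    invertible matrices over a field of [q] elements ([card_unit_det]). Likewise
    a random element of [R] is invertible with probability [1 - q^-1].

    Scaling a row by an invertible [u] is a bijection from the matrices of
    determinant [1] to those of determinant [u] ([card_det_fibre]). The matrices
    of invertible determinant are thus spread evenly over the invertible values,
    and dividing the two counts removes the factor [i = 1]:
    [d_n(R, 1) = #|R| ^ (n^2 - 1) * \prod_(2 <= i < n.+1) (1 - q^-i)].

    It remains to see that [#|R| = q ^ e]. Each step of the filtration
    [R = g^0 R], [g^1 R], ..., [g^e R = 0] has index [q]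
    ([card_pow_ideal_step]), because multiplication by [g^i] induces a bijection
    from [F = R / g R] to [g^i R / g^(i+1) R] as long as [g^i != 0]. *)

(** * Counting along fibres *)

Lemma card_field_gt0 (F : finFieldType) : (0 < #|F|)%N.
Proof. by apply/card_gt0P; exists 0. Qed.

Lemma card_fibres (aT rT : finType) (f : aT -> rT) (k : nat) (P : pred rT) :
    (forall y, P y -> #|[set x | f x == y]| = k) ->
  #|[set x | P (f x)]| = (k * #|P|)%N.
Proof.
move=> fk; rewrite -sum1_card (partition_big f P) /=; last by move=> x; rewrite inE.
rewrite mulnC -sum_nat_const; apply: eq_bigr => y Py.
rewrite -(fk y Py) -sum1_card; apply: eq_bigl => x; rewrite !inE.
by case: eqP => [->|]; rewrite ?andbF // Py.
Qed.

(** A surjective additive map sends the uniform distribution to the uniform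
    distribution: its fibres are translates of its kernel. *)
Lemma card_preim_additive (U V : finZmodType) (f : {additive U -> V})
    (P : pred V) :
    (forall y, exists x, f x = y) ->
  (#|[set x | P (f x)]| * #|V| = #|U| * #|P|)%N.
Proof.
move=> surj_f; set k := #|[set x | f x == 0]|.
have fibre_k y : #|[set x | f x == y]| = k.
  have [x0 <-] := surj_f y.
  rewrite /k -[RHS](card_imset _ (addrI x0)); apply: eq_card => x.
  rewrite inE; apply/idP/imsetP => [/eqP fx | [z + ->]].
    by exists (x - x0); rewrite ?inE ?raddfB ?fx ?subrr // addrC subrK.
  by rewrite inE raddfD => /eqP ->; rewrite addr0.
rewrite (card_fibres _ _ f k) => [|y _]; last exact: fibre_k.
suff -> : #|U| = (k * #|V|)%N by rewrite mulnAC.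
rewrite -(card_fibres _ _ f k predT) => [|y _]; last exact: fibre_k.
by apply: eq_card => x; rewrite !inE.
Qed.

(** * Surjections onto a field with nilpotent kernel *)

(** Inverting the image of [x] and lifting the result inverts [x] up to a
    nilpotent element, and [1] minus a nilpotent element is invertible. *)
Lemma unit_lift (R : comNzRingType) (F : fieldType) (phi : {rmorphism R -> F}) :
    (forall y, exists x, phi x = y) ->
    (forall x, phi x = 0 -> exists k, x ^+ k = 0) ->
  forall x, phi x != 0 -> exists y, x * y = 1.
Proof.
move=> surj_phi nil_ker x phix_neq0.
have [y phi_y] := surj_phi (phi x)^-1.
have [k zk0] : exists k, (1 - x * y) ^+ k = 0.
  by apply: nil_ker; rewrite rmorphB rmorphM rmorph1 phi_y divff // subrr.
(* The inverse of [x * y = 1 - z], with [z] nilpotent, is a geometric sum. *)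
exists (y * \sum_(i < k) (1 - x * y) ^+ i).
have := subrX1 (1 - x * y) k; rewrite zk0 sub0r addrAC subrr add0r mulNr.
by move=> eq1; apply: oppr_inj; rewrite mulrA eq1.
Qed.

(** Choose a set-theoretic section [s] of [phi]. The elements [g^i * s c] with
    [c] in [F] represent each coset of [g^(i+1) R] in [g^i R] once: subtracting
    [s (phi x)] from [x] leaves a multiple of [g], and two representatives of
    the same coset have the same [c], because an invertible [x] keeps [g^i * x]
    out of [g^(i+1) R]. *)
Lemma card_pow_ideal_step (R : finComNzRingType) (F : finFieldType)
    (phi : {rmorphism R -> F}) (g : R) (i : nat) :
    (forall y, exists x, phi x = y) ->
    (forall x, phi x != 0 -> exists y, x * y = 1) ->
    (forall x, phi x = 0 <-> exists a, x = g * a) ->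
    g ^+ i != 0 ->
  #|[set g ^+ i * x | x : R]| = (#|F| * #|[set (g ^+ i.+1 * x)%R | x : R]|)%N.
Proof.
move=> surj_phi unit_phi ker_phi gi_neq0.
have /fin_all_exists[s sK] := surj_phi.
(* If [phi x] were nonzero, [x - g * b], which has the same residue, would be
   invertible and annihilate [g ^+ i]. *)
have ker_step x b : g ^+ i * x = g ^+ i.+1 * b -> phi x = 0.
  move=> eq_xb; apply/eqP; apply: contraNT gi_neq0 => phix_neq0.
  have phig : phi g = 0 by apply/ker_phi; exists 1; rewrite mulr1.
  have [|y xy1] := unit_phi (x - g * b).
    by rewrite rmorphB rmorphM phig mul0r subr0.
  by rewrite -[g ^+ i]mulr1 -xy1 mulrA mulrBr eq_xb exprSr mulrA subrr mul0r.
pose h (p : F * R) := g ^+ i * s p.1 + p.2.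
rewrite -cardsT -cardsX -(@card_in_imset _ _ h); last first.
  move=> [c y] [c' y'] /setXP[_ /imsetP[/= b _ ->]].
  move=> /setXP[_ /imsetP[/= b' _ ->]]; rewrite /h /= => eq_h.
  suff cc' : c = c' by move: eq_h; rewrite cc' => /addrI ->.
  apply/eqP; rewrite -subr_eq0 -(sK c) -(sK c') -rmorphB; apply/eqP.
  apply: (ker_step _ (b' - b)); rewrite !mulrBr.
  by rewrite -[g ^+ i * s c](addrK (g ^+ i.+1 * b)) eq_h; ring.
apply: eq_card => z; apply/imsetP/imsetP => [[x _ ->]|[[c y]]].
  have /ker_phi[a xa] : phi (x - s (phi x)) = 0 by rewrite rmorphB sK subrr.
  exists (phi x, g ^+ i.+1 * a).
    by apply/setXP; split; [rewrite inE | apply: imset_f].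
  by rewrite /h /= exprSr -mulrA -xa -mulrDr addrC subrK.
move=> /setXP[_ /imsetP[/= b _ ->]] ->; exists (s c + g * b) => //.
by rewrite /h /= mulrDr exprSr mulrA.
Qed.

(** The indices of the successive powers of [g R] multiply to [#|R|]. *)
Lemma card_local_principal (R : finComNzRingType) (F : finFieldType)
    (phi : {rmorphism R -> F}) (g : R) (e : nat) :
    (forall y, exists x, phi x = y) ->
    (forall x, phi x != 0 -> exists y, x * y = 1) ->
    (forall x, phi x = 0 <-> exists a, x = g * a) ->
    g ^+ e = 0 -> (forall i, (i < e)%N -> g ^+ i != 0) ->
  #|R| = (#|F| ^ e)%N.
Proof.
move=> surj_phi unit_phi ker_phi ge0 lt_e.
have step j : (j <= e)%N ->
    #|R| = (#|F| ^ j * #|[set (g ^+ j * x)%R | x : R]|)%N.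
  elim: j => [_|j IHj lt_je].
    rewrite expn0 mul1n -[LHS]cardsT; apply: eq_card => x; rewrite inE.
    by apply/esym/imsetP; exists x => //; rewrite expr0 mul1r.
  rewrite (IHj (ltnW lt_je)) expnSr -mulnA.
  by rewrite (card_pow_ideal_step _ _ phi) // lt_e.
rewrite (step e) //.
suff -> : [set g ^+ e * x | x : R] = [set 0] by rewrite cards1 muln1.
apply/setP => x; rewrite inE; apply/imsetP/eqP => [[y _ ->]|->].
  by rewrite ge0 mul0r.
by exists 0; rewrite // mulr0.
Qed.

(** * Matrices of invertible determinant *)

(** Multiplying the first row by [u] multiplies the determinant by [u], and
    multiplying it by [v] undoes this. *)
Lemma card_det_fibre (R : finComNzRingType) (n : nat) (u v : R) :
  u * v = 1 -> #|[set A : 'M[R]_n.+1 | \det A == u]| = d_ n.+1 (1 : R).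
Proof.
move=> uv1.
pose scale0 (a : R) : 'M[R]_n.+1 :=
  diag_mx (\row_j if j == ord0 then a else 1).
have det_scale0 a : \det (scale0 a) = a.
  rewrite det_diag (bigD1 ord0) //= big1 ?mulr1 ?mxE //.
  by move=> j /negPf j_neq0; rewrite mxE j_neq0.
have scale0K a b : a * b = 1 ->
    cancel (mulmx (scale0 b) : 'M_n.+1 -> 'M_n.+1) (mulmx (scale0 a)).
  move=> ab1 A; rewrite mulmxA mulmx_diag.
  rewrite -[RHS]mul1mx -diag_const_mx; congr (diag_mx _ *m _).
  by apply/rowP => j; rewrite !mxE; case: ifP => // _; rewrite mulr1.
have inj_u : injective (mulmx (scale0 u) : 'M_n.+1 -> 'M_n.+1).
  by apply: (can_inj (scale0K v u _)); rewrite mulrC.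
rewrite /d_ -[RHS](card_imset _ inj_u); apply: eq_card => A; rewrite inE.
apply/idP/imsetP => [/eqP detA | [B + ->]].
  exists (scale0 v *m A); last by rewrite (scale0K u v).
  by rewrite inE det_mulmx det_scale0 detA mulrC uv1.
by rewrite inE det_mulmx det_scale0 => /eqP ->; rewrite mulr1.
Qed.

(** The order of the general linear group, rewritten as a proportion of all
    matrices: this is the form that transfers along surjections. *)
Lemma card_det_neq0 (F : finFieldType) (n : nat) :
  #|[pred B : 'M[F]_n.+1 | \det B != 0]|%:R =
    #|F|%:R ^+ (n.+1 ^ 2) * \prod_(1 <= i < n.+2) (1 - #|F|%:R ^- i) :> rat.
Proof.
have q_neq0 : #|F|%:R != 0 :> rat by rewrite pnatr_eq0 -lt0n card_field_gt0.
have -> : #|[pred B : 'M[F]_n.+1 | \det B != 0]| = #|'GL_n.+1[F]%g|.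
  rewrite cardsT card_sub; apply: eq_card => B.
  by rewrite !inE -topredE /= -unitfE.
rewrite card_GL // natrM natrX.
set q := #|F|%:R.
rewrite natr_prod.
(* Each factor [q ^ i - 1] is [q ^ i * (1 - q^-i)], and the exponents add up
   to [n ^ 2] since ['C(n, 2) + 'C(n.+1, 2) = n ^ 2]. *)
elim: n.+1 => [|m IHm]; first by rewrite !big_geq.
rewrite !(big_nat_recr m.+1) //= binS bin1 exprD.
rewrite natrB ?expn_gt0 ?card_field_gt0 // natrX -/q.
rewrite mulrACA IHm.
have -> : (m.+1 ^ 2 = m ^ 2 + m + m.+1)%N by rewrite !expnS; lia.
have -> : q ^+ m.+1 - 1 = q ^+ m.+1 * (1 - q ^- m.+1).
  by rewrite mulrBr mulr1 divff // expf_neq0.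
by rewrite !exprD; ring.
Qed.

(** The determinant commutes with [phi], so this counts the preimage of the
    general linear group under the surjective entrywise reduction. *)
Lemma card_unit_det (R : finComNzRingType) (F : finFieldType)
    (phi : {rmorphism R -> F}) (n : nat) :
    (forall y, exists x, phi x = y) ->
  #|[set A : 'M[R]_n.+1 | phi (\det A) != 0]|%:R =
    #|R|%:R ^+ (n.+1 ^ 2) * \prod_(1 <= i < n.+2) (1 - #|F|%:R ^- i) :> rat.
Proof.
move=> surj_phi.
have surj_mx (B : 'M[F]_n.+1) : exists A, map_mx phi A = B.
  have /fin_all_exists[s sK] : forall ij, exists x, phi x = B ij.1 ij.2.
    by move=> ij; apply: surj_phi.
  by exists (\matrix_(i, j) s (i, j)); apply/matrixP => i j; rewrite !mxE sK.
have := card_preim_additive _ _ (map_mx phi)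
  [pred B : 'M[F]_n.+1 | \det B != 0] surj_mx.
move/(congr1 (fun k : nat => k%:R : rat)).
rewrite !natrM card_det_neq0 !card_mx !natrX mulnn mulrCA.
have q_neq0 : #|F|%:R ^+ (n.+1 ^ 2) != 0 :> rat.
  by rewrite expf_neq0 // pnatr_eq0 -lt0n card_field_gt0.
rewrite [RHS]mulrC => /(mulIf q_neq0) <-.
by congr _%:R; apply: eq_card => A; rewrite !inE /= det_map_mx.
Qed.

Theorem theorem3p5 (R : finComNzRingType) (e q : nat) (F : finFieldType)
    (n : nat) :
  chain_ring R -> nilpotency_index R e ->
  residue_field R F -> #|F| = q -> (0 < n)%N ->
  (d_ n (1 : R))%:R =
    q%:R ^+ (e * (n ^ 2 - 1)) * \prod_(2 <= i < n.+1) (1 - q%:R ^- i) :> rat.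
Proof.
move=> _ [m [g [max_m gen_m e_gt0 ge0 min_e]]] [m' [f [_ bij_f]]] <-.
case: n => // n _.
pose phi : {rmorphism R -> F} :=
  f \o (\pi_({ideal_quot m'})%qT : {rmorphism R -> _}).
have surj_phi y : exists x, phi x = y.
  have [f' _ f'K] := bij_f.
  by exists (repr (f' y))%qT; rewrite /phi /= reprK f'K.
have phi0 x : (phi x == 0) = (x \in m').
  rewrite /phi /= -(rmorph0 f) (inj_eq (bij_inj bij_f)) -[x in RHS]subr0.
  by rewrite Quotient.idealrBE rmorph0.
have lt_e i : (i < e)%N -> g ^+ i != 0.
  case: i => [|i] lt_ie; first by rewrite expr0 oner_eq0.
  by apply/eqP => gi0; have := min_e i.+1 isT gi0; rewrite leqNgt lt_ie.
have nil_m x : x \in m -> x ^+ e = 0.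
  by case/gen_m => a ->; rewrite exprMn ge0 mul0r.
(* The nilpotent elements of [R] vanish in the field [F]; so [m] is contained
   in the kernel of [phi], and equal to it by maximality. *)
have m'_m : m' =i m.
  apply: max_m => x /nil_m xe0; rewrite -phi0.
  have /eqP := rmorphXn phi e x; rewrite xe0 rmorph0 eq_sym expf_eq0.
  by case/andP.
have ker_phi x : phi x = 0 <-> exists a, x = g * a.
  by rewrite -gen_m -m'_m -phi0; split => [->|/eqP].
have unit_phi : forall x, phi x != 0 -> exists y, x * y = 1.
  apply: unit_lift => // x /ker_phi/gen_m x_m.
  by exists e; apply: nil_m.
have cardR := card_local_principal _ _ phi g e surj_phi unit_phi ker_phi ge0 lt_e.
set d := d_ n.+1 (1 : R); pose units := [set u : R | phi u != 0].
have count_det : #|[set A : 'M[R]_n.+1 | phi (\det A) != 0]| = (d * #|units|)%N.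
  rewrite [#|units|]cardsE.
  apply: (card_fibres _ _ (fun A : 'M[R]_n.+1 => \det A) d
            (fun u => phi u != 0)).
  move=> u /unit_phi[v uv1]; exact: (card_det_fibre _ _ u v).
have q_neq0 : #|F|%:R != 0 :> rat by rewrite pnatr_eq0 -lt0n card_field_gt0.
have count_units : #|units|%:R = #|R|%:R * (1 - #|F|%:R^-1) :> rat.
  have := card_preim_additive _ _ phi (predC1 0) surj_phi.
  move/(congr1 (fun k : nat => k%:R : rat)).
  rewrite !natrM cardC1 -subn1 natrB ?card_field_gt0 // => eq_units.
  by apply: (mulIf q_neq0); rewrite eq_units -mulrA mulrBl mul1r mulVf.
have := card_unit_det _ _ phi n surj_phi.
rewrite count_det natrM count_units big_ltn // expr1.
have units_neq0 : #|R|%:R * (1 - #|F|%:R^-1) != 0 :> rat.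
  rewrite -count_units pnatr_eq0 -lt0n; apply/card_gt0P.
  by exists 1; rewrite inE rmorph1 oner_eq0.
(* Both sides of the goal are compared after multiplication by the number of
   invertible elements, which is the factor [i = 1] times [#|R|]. *)
set k := (n.+1 ^ 2 - 1)%N.
have -> : (n.+1 ^ 2 = k.+1)%N by rewrite /k subn1 prednK // expn_gt0.
move=> eq_d; apply: (mulIf units_neq0); rewrite {}eq_d.
by rewrite exprM -(natrX _ #|F|) -cardR exprS; ring.
Qed.
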